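(* Let $n\in\mathbb{N}$ and $f\in C_B(\mathbb{R})\cup C_U(\mathbb{R})$. Then $$\omega(A_n^*(f),\theta)\le\omega(f,\theta)\qquad\text{for every }\theta>0.$$ Furthermore, if $f\in C_U(\mathbb{R})$, then $A_n^*(f)\in C_U(\mathbb{R})$.
   Context: Fix real parameters $q>0$, $\beta>0$, $B>1$; $\mathbb{N}=\{1,2,3,\dots\}$. For $x\in\mathbb{R}$ and any $p>0$ put $$\nu_{p,\beta}(x)=\frac{1}{1+pB^{-\beta x}},\qquad G_{p,\beta}(x)=\tfrac12\big(\nu_{p,\beta}(x+1)-\nu_{p,\beta}(x-1)\big),\qquad \Psi(x)=\tfrac12\big(G_{q,\beta}(x)+G_{1/q,\beta}(x)\big).$$ $C_B(\mathbb{R})$ is the set of continuous bounded functions $f:\mathbb{R}\to\mathbb{R}$; $C_U(\mathbb{R})$ is the set of all uniformly continuous (not necessarily bounded) functions $f:\mathbb{R}\to\mathbb{R}$. The modulus of continuity is $\omega(f,\theta)=\sup\{|f(x)-f(y)|: x,y\in\mathbb{R},\ |x-y|\le\theta\}$ for $\theta>0$. For $n\in\mathbb{N}$ the Kantorovich type operator $A_n^*$ is given (for unbounded $f$ by the same formula) by $$A_n^*(f)(x)=n\int_{-\infty}^{\infty}\left(\int_{v/n}^{(v+1)/n} f(h)\,dh\right)\Psi(nx-v)\,dv=n\int_{-\infty}^{\infty}\left(\int_0^{1/n} f\!\left(h+\frac vn\right)dh\right)\Psi(nx-v)\,dv .$$ *)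

(* Defs.v *)
From HB Require Import structures.
From mathcomp Require Import all_boot all_order all_algebra.
From mathcomp Require Import all_classical all_reals all_analysis.
Set Implicit Arguments.
Unset Strict Implicit.
Unset Printing Implicit Defensive.
Import Order.TTheory GRing.Theory Num.Theory.
Import numFieldNormedType.Exports.
Local Open Scope classical_set_scope.
Local Open Scope ring_scope.

Definition nu (R : realType) (B p beta x : R) : R :=
  (1 + p * B `^ (- (beta * x)))^-1.

Definition G (R : realType) (B p beta x : R) : R :=
  2^-1 * (nu B p beta (x + 1) - nu B p beta (x - 1)).

Definition Psi (R : realType) (B q beta x : R) : R :=
  2^-1 * (G B q beta x + G B q^-1 beta x).

Definition CB (R : realType) : set (R -> R) :=
  [set f | continuous f /\ bounded_fun f].

Definition CU (R : realType) : set (R -> R) := [set f | unif_continuous f].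

(* The supremum is taken in the extended reals, so that it is [+oo], rather
   than a default real value, when the oscillations of [f] are unbounded. *)
Definition omega (R : realType) (f : R -> R) (theta : R) : \bar R :=
  ereal_sup [set `|f z.1 - f z.2|%:E |
             z in [set z : R * R | `|z.1 - z.2| <= theta]].

(* Both integrals are real-valued Lebesgue integrals ([Rintegral]); for [f]
   continuous and bounded, or uniformly continuous, both integrands are
   integrable: [f] grows at most linearly and [Psi] decays exponentially. *)
Definition Kantorovich (R : realType) (B q beta : R) (n : nat) (f : R -> R)
    (x : R) : R :=
  n%:R * \int[lebesgue_measure]_(v in [set: R])
    ((\int[lebesgue_measure]_(h in `[v / n%:R, (v + 1) / n%:R]) f h)
     * Psi B q beta (n%:R * x - v)).

(* Main.v *)
(* After the substitution [u = n x - v], the operator reads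
   [A f x = n * \int_u F (n x - u) Psi u], where [F] is the integral of [f] over
   a window of length [1/n].  If [f] oscillates by at most [w] at scale [theta],
   then [F] oscillates by at most [w/n] at scale [n theta].  Since [Psi >= 0] has
   total mass at most 1, so does [A f] by at most [w] at scale [theta].  The mass
   bound holds because [G] has a primitive with values in [0, 1], namely half the
   increment over [x - 1, x + 1] of a primitive of [nu], which is nondecreasing
   and 1-Lipschitz. *)

Require Import Defs.
From HB Require Import structures.
From mathcomp Require Import all_boot all_order all_algebra.
From mathcomp Require Import all_classical all_reals all_analysis.
From mathcomp Require Import measurable_realfun ring lra.
Set Implicit Arguments.
Unset Strict Implicit.
Unset Printing Implicit Defensive.
Import Order.TTheory GRing.Theory Num.Theory.
Import numFieldNormedType.Exports.
Local Open Scope classical_set_scope.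
Local Open Scope ring_scope.

(** * Real-valued integrals of functions that may fail to be integrable *)

Lemma Rintegral_nonintegrable d (T : measurableType d) (R : realType)
    (mu : {measure set T -> \bar R}) (g : T -> R) :
  measurable_fun setT g -> ~ mu.-integrable setT (EFin \o g) ->
  \int[mu]_(t in setT) g t = 0.
Proof.
(* For measurable [g], a finite integral forces integrability: if both parts diverge, [+oo - +oo] is
   [-oo]. So the integral is infinite here, and [fine] sends it to 0. *)
move=> mg ng; have : (\int[mu]_(t in setT) (g t)%:E)%E \isn't a fin_num.
  apply/negP; rewrite -integral_fin_num_abs// => gfin.
  by apply: ng; apply/integrableP; split => //; exact/measurable_EFinP.
by rewrite /Rintegral; case: (integral _ _ _).
Qed.

(* [g1] and [g2] are integrable together; if they are not, both real integrals
   are the junk value 0, the image by [fine] of an infinite extended integral.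
   This dispenses with decay estimates on [Psi]. *)
Lemma le_normr_RintegralB d (T : measurableType d) (R : realType)
    (mu : {measure set T -> \bar R}) (g1 g2 k : T -> R) :
  measurable_fun setT g1 -> measurable_fun setT g2 ->
  mu.-integrable setT (EFin \o k) -> (forall t, `|g1 t - g2 t| <= k t) ->
  `|\int[mu]_(t in setT) g1 t - \int[mu]_(t in setT) g2 t|
    <= \int[mu]_(t in setT) k t.
Proof.
move=> mg1 mg2 ik gk.
have iB : mu.-integrable setT (EFin \o (g1 \- g2)).
  apply: (le_integrable _ _ _ ik) => //.
    exact/measurable_EFinP/measurable_funB.
  by move=> t _ /=; rewrite lee_fin (le_trans (gk t))// ler_norm.
have [i1|n1] := pselect (mu.-integrable setT (EFin \o g1)).
  have i2 : mu.-integrable setT (EFin \o g2).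
    apply: (@eq_integrable _ _ _ _ _ measurableT
      ((EFin \o g1) \- (EFin \o (g1 \- g2)%R))%E).
      by move=> t _ /=; rewrite -EFinB opprB addrC subrK.
    exact: integrableB.
  rewrite -RintegralB// (le_trans (le_normr_Rintegral _ _))//.
  apply: le_Rintegral => //; exact: integrable_norm.
have n2 : ~ mu.-integrable setT (EFin \o g2).
  move=> i2; apply: n1; apply: (@eq_integrable _ _ _ _ _ measurableT
    ((EFin \o (g1 \- g2)%R) \+ (EFin \o g2))%E).
    by move=> t _ /=; rewrite -EFinD subrK.
  exact: integrableD.
rewrite (Rintegral_nonintegrable mg1 n1) (Rintegral_nonintegrable mg2 n2).
rewrite subrr normr0; apply: Rintegral_ge0 => t _.
exact: le_trans (gk t).
Qed.

(** * Integration on the line: reflections, and mass bounded through a primitive *)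

Lemma pushforward_lebesgue_measure_subl (R : realType) (c : R) (A : set R) :
  measurable A ->
  pushforward lebesgue_measure ((fun x => c - x) : _ -> measurableTypeR R) A =
  lebesgue_measure A.
Proof.
have mphi : measurable_fun setT ((fun x : R => c - x) : _ -> measurableTypeR R).
  exact: measurable_funB.
move=> mA; apply/esym.
apply: (@lebesgue_measure_unique R
  (pushforward lebesgue_measure ((fun x => c - x) : _ -> measurableTypeR R)))
  => //= _ [[a b]] _ <-.
rewrite /pushforward.
(* The reflection swaps the open and closed ends; the length is unchanged. *)
have -> : (fun x : R => c - x) @^-1` `]a, b]%classic = `[c - b, c - a[%classic.
  by apply/seteqP; split => x /=; rewrite !in_itv/=; lra.
rewrite !lebesgue_measure_itv/= !lte_fin ltrD2l ltrN2 -!EFinD.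
by case: ifP => // _; congr (_%:E); ring.
Qed.

(** The substitution is valid for the positive and negative parts separately, hence for [g] whether
    or not it is integrable. *)
Lemma integral_subl (R : realType) (c : R) (D : set R) (g : R -> \bar R) :
  measurable D -> measurable_fun D g ->
  (\int[lebesgue_measure]_(x in D) g x =
   \int[lebesgue_measure]_(x in [set x | D (c - x)%R]) g (c - x)%R)%E.
Proof.
move=> mD mg.
have mphi : measurable_fun setT ((fun x : R => c - x) : _ -> measurableTypeR R).
  exact: measurable_funB.
have ge0 (h : R -> \bar R) : measurable_fun D h -> (forall x, 0 <= h x)%E ->
    (\int[lebesgue_measure]_(x in D) h x =
   \int[lebesgue_measure]_(x in [set x | D (c - x)%R]) h (c - x)%R)%E.
  move=> mh h0.
  transitivity (\int[pushforward lebesgue_measure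
      ((fun x => c - x)%R : _ -> measurableTypeR R)]_(x in D) h x)%E; last first.
    by rewrite ge0_integral_pushforward.
  apply: eq_measure_integral => A mA _; apply/esym.
  exact: pushforward_lebesgue_measure_subl.
rewrite integralE [RHS]integralE; congr (_ - _)%E.
- rewrite (ge0 (funepos g))//; last exact: measurable_funepos.
  by apply: eq_integral => x _; rewrite !funeposE.
- rewrite (ge0 (funeneg g))//; last exact: measurable_funeneg.
  by apply: eq_integral => x _; rewrite !funenegE.
Qed.

(** The integral over [[-i, i]] is [K i - K (- i)], at most [c]; monotone convergence passes to the
    whole line. *)
Lemma ge0_integral_le_primitive (R : realType) (g K : R -> R) (c : R) :
  continuous g -> (forall x, 0 <= g x) ->
  (forall x : R, is_derive x 1 K (g x)) -> (forall x y, K y - K x <= c) ->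
  (\int[lebesgue_measure]_(x in setT) (g x)%:E <= c%:E)%E.
Proof.
move=> cg g0 dK Kc.
have cK : continuous K.
  move=> x; apply/differentiable_continuous/derivable1_diffP.
  by have := dK x; case.
pose F i := `[- i%:R, i%:R]%classic : set R.
have FT : \bigcup_i F i = setT by exact: bigcup_itvT.
rewrite -FT.
have Fg : (\int[lebesgue_measure]_(x in F i) (g x)%:E)%E @[i --> \oo] -->
    (\int[lebesgue_measure]_(x in \bigcup_i F i) (g x)%:E)%E.
  apply: ge0_nondecreasing_set_cvg_integral => //.
  - move=> i j ij; apply/subsetPset; apply: subset_itv;
    by rewrite bnd_simp ?lerN2 ler_nat.
  - by move=> i; exact: measurable_itv.
  - move=> i; apply/measurable_EFinP/measurable_funTS.
    exact: continuous_measurable_fun.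
  - by move=> i x _; rewrite lee_fin.
rewrite -(cvg_lim _ Fg)//; apply: lime_le; first exact: cvgP Fg.
apply: nearW => -[|i].
  (* For index 0 the interval is a single point, while [continuous_FTC2] needs distinct endpoints;
     [Kc 0 0] gives [0 <= c]. *)
  rewrite /F oppr0 set_itv1 integral_set1 lee_fin.
  by apply: le_trans (Kc 0 0); rewrite subrr.
rewrite /F (@continuous_FTC2 _ g K).
- by rewrite -EFinB lee_fin.
- by rewrite (@lt_trans _ _ 0)// ?oppr_lt0 ltr0n.
- exact: continuous_subspaceT.
- split=> [x _||].
  + by have := dK x; case.
  + exact/cvg_at_right_filter/cK.
  + exact/cvg_at_left_filter/cK.
- by move=> x _; rewrite derive1E; have := dK x; case.
Qed.

(** * The kernel: continuity, sign and total mass *)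

Section kernel.
Variables (R : realType) (B beta : R).
Hypotheses (beta_gt0 : 0 < beta) (B_gt1 : 1 < B).
Let L := beta * ln B.

Let L_gt0 : 0 < L.
Proof. by rewrite mulr_gt0// ln_gt0. Qed.

Lemma nuE (p x : R) : nu B p beta x = (1 + p * expR (- (L * x)))^-1.
Proof.
rewrite /nu /powR gt_eqF ?(lt_trans ltr01)//; congr (1 + p * expR _)^-1.
by rewrite mulNr /L mulrAC.
Qed.

Let nu_den_gt0 (p x : R) : 0 < p -> 0 < 1 + p * expR (- (L * x)).
Proof. by move=> p0; rewrite addr_gt0// mulr_gt0// expR_gt0. Qed.

Lemma continuous_nu (p : R) : 0 < p -> continuous (nu B p beta).
Proof.
move=> p0; have -> : nu B p beta = (fun x => (1 + p * expR (- (L * x)))^-1).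
  by apply/funext => x; exact: nuE.
move=> x; apply: cvgV; first by rewrite gt_eqF ?nu_den_gt0.
apply: cvgD; first exact: cvg_cst.
apply: cvgM; first exact: cvg_cst.
apply: continuous_comp; last exact: continuous_expR.
by apply: cvgN; apply: cvgM; [exact: cvg_cst|exact: cvg_id].
Qed.

Lemma continuous_G (p : R) : 0 < p -> continuous (G B p beta).
Proof.
move=> p0.
have cshift c : continuous (fun x => nu B p beta (x + c)).
  move=> x; apply: (@continuous_comp _ _ _ (+%R^~ c) (nu B p beta)).
    by apply: cvgD; [exact: cvg_id|exact: cvg_cst].
  exact: continuous_nu.
move=> x; rewrite /G; apply: cvgM; first exact: cvg_cst.
by apply: cvgB; exact: cshift.
Qed.

Lemma G_ge0 (p x : R) : 0 < p -> 0 <= G B p beta x.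
Proof.
move=> p0; rewrite /G mulr_ge0// subr_ge0 !nuE lef_pV2 ?posrE ?nu_den_gt0//.
rewrite lerD2l ler_pM2l// ler_expR lerN2 ler_pM2l//; lra.
Qed.

(** Multiplying numerator and denominator of [nu] by [expR (L * x)] exhibits it as a logarithmic
    derivative, up to the factor [L]. *)
Definition nu_primitive (p x : R) : R := L^-1 * ln (expR (L * x) + p).

Lemma is_derive_nu_primitive (p x : R) : 0 < p ->
  is_derive x 1 (nu_primitive p) (nu B p beta x).
Proof.
move=> p0.
have E0 : 0 < expR (L * x) + p by rewrite addr_gt0// expR_gt0.
have dL : is_derive x 1 (fun x : R => L * x) L.
  by apply: is_derive_eq; rewrite /GRing.scale/= mulr1.
have dexp : is_derive x 1 (fun x : R => expR (L * x) + p) (expR (L * x) * L).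
  rewrite -[_ * L]addr0.
  exact: (is_deriveD (is_derive1_comp (is_derive_expR _) dL)
    (is_derive_cst p x 1)).
have dln : is_derive x 1 (fun x : R => ln (expR (L * x) + p))
    ((expR (L * x) + p)^-1 * (expR (L * x) * L)).
  apply: (is_derive1_comp (f := @ln R) (g := fun x : R => expR (L * x) + p)).
  exact: is_derive1_ln.
have := is_deriveZ L^-1 dln; congr is_derive.
rewrite nuE expRN /GRing.scale/=.
have Ex := expR_gt0 (L * x).
by field; rewrite !gt_eqF.
Qed.

Definition G_primitive (p x : R) : R :=
  2^-1 * (nu_primitive p (x + 1) - nu_primitive p (x - 1)).

Lemma is_derive_G_primitive (p x : R) : 0 < p ->
  is_derive x 1 (G_primitive p) (G B p beta x).
Proof.
move=> p0.
have dshift c : is_derive x 1 (fun x => nu_primitive p (x + c))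
    (nu B p beta (x + c)).
  rewrite -[nu _ _ _ _]mulr1.
  apply: (is_derive1_comp (f := nu_primitive p) (g := +%R^~ c)).
    exact: is_derive_nu_primitive.
  exact: is_derive_shift.
exact: (is_deriveZ 2^-1 (is_deriveB (dshift 1) (dshift (- 1)))).
Qed.

Lemma G_primitive_itv (p x : R) : 0 < p -> 0 <= G_primitive p x <= 1.
Proof.
move=> p0.
have E0 y : 0 < expR (L * y) + p by rewrite addr_gt0// expR_gt0.
have mono : nu_primitive p (x - 1) <= nu_primitive p (x + 1).
  rewrite /nu_primitive ler_pM2l ?invr_gt0// ler_ln ?posrE// lerD2r ler_expR.
  by rewrite ler_pM2l//; lra.
(* Scaled by [L] and exponentiated, this says that [expR (L * (x + 1)) + p] is at most
   [(expR (L * (x - 1)) + p) * expR (L * 2)]; it holds because [1 <= expR (L * 2)]. *)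
have lip : nu_primitive p (x + 1) <= nu_primitive p (x - 1) + 2.
  rewrite /nu_primitive -[leRHS](mulKf (lt0r_neq0 L_gt0)).
  rewrite ler_pM2l ?invr_gt0// [leRHS]mulrDr mulVKf ?lt0r_neq0//.
  rewrite -[L * 2]expRK -lnM ?posrE ?expR_gt0//.
  rewrite ler_ln ?posrE ?mulr_gt0 ?expR_gt0// mulrDl -expRD.
  have -> : L * (x - 1) + L * 2 = L * (x + 1) by ring.
  by rewrite lerD2l ler_pMr// -expR0 ler_expR mulr_ge0// ltW.
rewrite /G_primitive; apply/andP; split; lra.
Qed.

End kernel.

Lemma continuous_Psi (R : realType) (B q beta : R) :
  0 < q -> 0 < beta -> 1 < B ->
  continuous (Psi B q beta).
Proof.
move=> q0 beta0 B1 x; rewrite /Psi; apply: cvgM; first exact: cvg_cst.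
by apply: cvgD; apply: continuous_G; rewrite ?invr_gt0.
Qed.

Lemma Psi_ge0 (R : realType) (B q beta x : R) : 0 < q -> 0 < beta -> 1 < B ->
  0 <= Psi B q beta x.
Proof.
by move=> q0 beta0 B1; rewrite mulr_ge0// addr_ge0// G_ge0// invr_gt0.
Qed.

(** The primitive [K], an average of two functions with values in [0, 1], has increments at most
    1. *)
Lemma integral_Psi_le1 (R : realType) (B q beta : R) :
  0 < q -> 0 < beta -> 1 < B ->
  (\int[lebesgue_measure]_(x in setT) (Psi B q beta x)%:E <= 1)%E.
Proof.
move=> q0 beta0 B1; have qV0 : 0 < q^-1 by rewrite invr_gt0.
pose K (x : R) := 2^-1 * (G_primitive B beta q x + G_primitive B beta q^-1 x).
apply: (@ge0_integral_le_primitive _ (Psi B q beta) K 1).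
- exact: continuous_Psi.
- by move=> x; exact: Psi_ge0.
- move=> x; exact: (is_deriveZ 2^-1 (is_deriveD
    (is_derive_G_primitive beta0 B1 x q0)
    (is_derive_G_primitive beta0 B1 x qV0))).
- move=> x y; rewrite /K.
  have /andP[] := G_primitive_itv beta0 B1 x q0.
  have /andP[] := G_primitive_itv beta0 B1 y q0.
  have /andP[] := G_primitive_itv beta0 B1 x qV0.
  have /andP[] := G_primitive_itv beta0 B1 y qV0.
  lra.
Qed.

Lemma Rintegral_subl (R : realType) (c : R) (D : set R) (g : R -> R) :
  measurable D -> measurable_fun D g ->
  \int[lebesgue_measure]_(x in D) g x =
  \int[lebesgue_measure]_(x in [set x | D (c - x)]) g (c - x).
Proof.
move=> mD mg; rewrite /Rintegral (@integral_subl _ c _ (EFin \o g))//.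
exact/measurable_EFinP.
Qed.

(** * Integrals of [f] over a sliding window *)

Section window.
Variables (R : realType) (r : R) (f : R -> R).
Hypotheses (r_gt0 : 0 < r) (cf : continuous f).

Definition window (v : R) : R :=
  \int[lebesgue_measure]_(h in `[v / r, (v + 1) / r]) f h.

(** Reflecting about the right end of the window fixes the domain of integration, so that two
    windows can be compared pointwise and Tonelli applies. *)
Lemma windowE (v : R) :
  window v = \int[lebesgue_measure]_(h in `[0, r^-1]) f ((v + 1) / r - h).
Proof.
rewrite /window (@Rintegral_subl _ ((v + 1) / r))//; last first.
  by apply: measurable_funTS; exact: continuous_measurable_fun.
congr (Rintegral _ _ _); apply/seteqP; split => h /=; rewrite !in_itv/=;
  rewrite mulrDl mul1r; move: (v / r) (r^-1) => a b; lra.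
Qed.

(** By Tonelli, the positive and negative parts of the integrand, cut off by an indicator, have
    integrals over [h] measurable in [v]; [window] is [fine] of their difference. *)
Lemma measurable_window : measurable_fun setT window.
Proof.
pose phi (p : R * R) :=
  (f ((p.1 + 1) / r - p.2) * \1_(`[0, r^-1]%classic) p.2)%:E.
have mphi : measurable_fun setT phi.
  apply/measurable_EFinP; apply: measurable_funM; last first.
    exact: measurableT_comp.
  apply: (measurableT_comp (f := f)); first exact: continuous_measurable_fun.
  by apply: measurable_funB => //; apply: measurable_funM => //;
    exact: measurable_funD.
have -> : window = fun v => fine
    (fubini_F lebesgue_measure phi^\+ v - fubini_F lebesgue_measure phi^\- v)%E.
  apply/funext => v; rewrite windowE Rintegral_mkcond /Rintegral integralE.
  congr (fine (_ - _)); apply: eq_integral => h _;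
    rewrite ?funeposE ?funenegE /phi/= patchE indicE; case: ifP => _;
    by rewrite ?mulr1 ?mulr0.
apply: measurableT_comp; first exact: fine_measurable.
by apply: emeasurable_funB; apply: measurable_fun_fubini_tonelli_F => //;
  [exact: measurable_funepos|exact: measurable_funeneg].
Qed.

(** In the form [windowE], arguments of [f] with the same [h] are [(v - v') / r] apart, and the
    domain has length [1 / r]. *)
Lemma window_dist (theta w v v' : R) :
  (forall a b, `|a - b| <= theta -> `|f a - f b| <= w) ->
  `|v - v'| <= r * theta -> `|window v - window v'| <= w / r.
Proof.
move=> fw vv'; rewrite !windowE.
have rV0 : 0 < r^-1 by rewrite invr_gt0.
have ci (g : R -> R) : continuous g ->
    lebesgue_measure.-integrable `[0, r^-1] (EFin \o g).
  move=> cg; apply: continuous_compact_integrable; first exact: segment_compact.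
  exact: continuous_subspaceT.
have cfr c : continuous (fun h => f (c - h)).
  move=> h; apply: (@continuous_comp _ _ _ (fun h => c - h) f); last exact: cf.
  by apply: cvgB; [exact: cvg_cst|exact: cvg_id].
have iB : lebesgue_measure.-integrable `[0, r^-1]
    (EFin \o (fun h => f ((v + 1) / r - h) - f ((v' + 1) / r - h))).
  by apply: ci => h; apply: cvgB; exact: cfr.
rewrite -RintegralB//; [|exact: ci|exact: ci].
rewrite (le_trans (le_normr_Rintegral _ iB))//.
have -> : w / r = \int[lebesgue_measure]_(h in `[0, r^-1]) w.
  rewrite Rintegral_cst//= lebesgue_measure_itv/= lte_fin rV0.
  by rewrite -EFinD subr0.
apply: le_Rintegral => //.
- exact: integrable_norm.
- by apply: ci => h; exact: cvg_cst.
- move=> h _; apply: fw.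
  have -> : (v + 1) / r - h - ((v' + 1) / r - h) = (v - v') / r.
    by field; rewrite gt_eqF.
  by rewrite normrM (gtr0_norm rV0) ler_pdivrMr// mulrC.
Qed.

End window.

(** * Oscillation of the operator *)

Lemma KantorovichE (R : realType) (B q beta : R) (n : nat) (f : R -> R)
    (x : R) :
  0 < q -> 0 < beta -> 1 < B -> (0 < n)%N -> continuous f ->
  Kantorovich B q beta n f x =
  n%:R * \int[lebesgue_measure]_u
    (window n%:R f (n%:R * x - u) * Psi B q beta u).
Proof.
move=> q0 beta0 B1 n0 cf; rewrite /Kantorovich; congr (_ * _).
(* This moves [x] from the kernel into the window, where the oscillation of [f] controls it. *)
rewrite (@Rintegral_subl _ (n%:R * x))//.
  by apply: eq_Rintegral => u _; congr (_ * Psi _ _ _ _); ring.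
apply: measurable_funM; first by apply: measurable_window; rewrite ?ltr0n.
apply: (measurableT_comp (f := Psi B q beta)).
  by apply: continuous_measurable_fun; exact: continuous_Psi.
exact: measurable_funB.
Qed.

(** Taking an arbitrary bound [w] lets the same estimate serve for [omega] and for the epsilon-delta
    form of uniform continuity. *)
Lemma Kantorovich_dist (R : realType) (B q beta : R) (n : nat) (f : R -> R)
    (theta w x y : R) :
  0 < q -> 0 < beta -> 1 < B -> (0 < n)%N -> continuous f -> 0 <= theta ->
  (forall a b, `|a - b| <= theta -> `|f a - f b| <= w) ->
  `|x - y| <= theta ->
  `|Kantorovich B q beta n f x - Kantorovich B q beta n f y| <= w.
Proof.
move=> q0 beta0 B1 n0 cf theta0 fw xy; rewrite !KantorovichE//.
have nR0 : 0 < n%:R :> R by rewrite ltr0n.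
have w0 : 0 <= w by apply: le_trans (fw 0 0 _); rewrite subrr ?normr0.
have mPsi : measurable_fun setT (Psi B q beta).
  by apply: continuous_measurable_fun; exact: continuous_Psi.
have Psi1 := integral_Psi_le1 q0 beta0 B1.
have iPsi : lebesgue_measure.-integrable setT (EFin \o Psi B q beta).
  apply/integrableP; split; first exact/measurable_EFinP.
  under eq_integral do rewrite gee0_abs ?lee_fin ?Psi_ge0//.
  exact: le_lt_trans Psi1 (ltry _).
have mW c : measurable_fun [set: measurableTypeR R]
    (fun u : R => window n%:R f (c - u) * Psi B q beta u).
  apply: measurable_funM => //.
  apply: (measurableT_comp (f := window n%:R f)).
    exact: measurable_window.
  exact: measurable_funB.
rewrite -mulrBr normrM gtr0_norm//.
(* The factor 1 stands for the bound on the mass of [Psi], and [w / n%:R] for the oscillation of the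
   window. *)
have -> : w = n%:R * (w / n%:R * 1) by field; rewrite gt_eqF.
rewrite ler_pM2l//.
have ik : lebesgue_measure.-integrable setT
    (EFin \o (fun u => w / n%:R * Psi B q beta u)).
  exact: (integrableZl _ _ iPsi).
rewrite (le_trans (le_normr_RintegralB (mW _) (mW _) ik _))//.
  move=> u; rewrite -mulrBl normrM (ger0_norm (Psi_ge0 _ _ _ _))//.
  apply: ler_wpM2r; first exact: Psi_ge0.
  apply: (window_dist _ _ fw) => //.
  have -> : n%:R * x - u - (n%:R * y - u) = n%:R * (x - y) by ring.
  by rewrite normrM gtr0_norm// ler_pM2l.
rewrite RintegralZl//; apply: ler_wpM2l; first by rewrite divr_ge0// ltW.
by rewrite -lee_fin /Rintegral fineK//; exact: integrable_fin_num.
Qed.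

Lemma unif_continuous_continuous (R : realType) (f : R -> R) :
  unif_continuous f -> continuous f.
Proof.
move=> /unif_continuousP fu x; apply/cvgrPdist_lt => e e0.
have [d d0 fd] := fu e e0.
by exists d => // y xy; exact: (fd (x, y)).
Qed.

Lemma omega_ge (R : realType) (f : R -> R) (theta x y : R) :
  `|x - y| <= theta -> (`|f x - f y|%:E <= omega f theta)%E.
Proof. by move=> xy; apply: ereal_sup_ubound; exists (x, y). Qed.

Theorem theorem6 (R : realType) (q beta B : R)
    (q_gt0 : 0 < q) (beta_gt0 : 0 < beta) (B_gt1 : 1 < B)
    (n : nat) (n_gt0 : (0 < n)%N) (f : R -> R) (hf : (@CB R `|` @CU R) f) :
  (forall theta : R, 0 < theta ->
     (omega (Kantorovich B q beta n f) theta <= omega f theta)%E) /\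
  (@CU R f -> @CU R (Kantorovich B q beta n f)).
Proof.
have cf : continuous f by case: hf => [[]//|];
  exact: unif_continuous_continuous.
split=> [theta theta0|/unif_continuousP fu].
  have omega_f := @omega_ge _ f theta.
  apply: ge_ereal_sup => _ [[x y] /= xy <-].
  (* The value [+oo] bounds everything; [-oo] is impossible, since the supremum is at least the zero
     oscillation at the pair (0, 0). *)
  case: (omega f theta) omega_f => [w||] omega_f; last 2 first.
  - by rewrite leey.
  - by have := omega_f 0 0; rewrite subrr normr0 ltW// => /(_ isT).
  rewrite lee_fin; apply: Kantorovich_dist xy => //; exact: ltW.
apply/unif_continuousP => e e0.
(* Halving [e] and then [d] reconciles the strict inequalities of uniform continuity with the large
   ones of [Kantorovich_dist]. *)
have [d d0 fd] := fu _ (divr_gt0 e0 (ltr0Sn _ 1)).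
have d2 : 0 < d / 2 by rewrite divr_gt0.
exists (d / 2) => // -[x y] /= xy.
apply: (@le_lt_trans _ _ (e / 2)); last by lra.
apply: (@Kantorovich_dist _ _ _ _ _ _ (d / 2)) => //; [exact: ltW| |exact: ltW].
move=> a b ab; apply: ltW; apply: (fd (a, b)); rewrite /ball/=; lra.
Qed.
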